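(* Let $A=\mathbb{K}[x_0,\ldots,x_r]/I$ be an Artinian quotient by an ideal $I$ generated by quadratic monomials over a field $\mathbb{K}$ of characteristic zero, let $\Delta$ be the associated flag complex, fix a degree $i\ge 0$, and let $\Delta(i)$ be the $i$-skeleton of $\Delta$. Let $\mu_\ell:A_i\to A_{i+1}$ be multiplication by $\ell=x_0+\cdots+x_r$, and let $$\delta:H_i(\Delta(i),\mathbb{Z}/2)\longrightarrow \mathrm{coker}(\mu_\ell^\vee)$$ be the connecting homomorphism described in the context. Then: (1) If $\delta$ is not injective (and therefore $H_i(\Delta(i),\mathbb{Z}/2)\neq 0$), then $\mu_\ell:A_i\to A_{i+1}$ is not surjective; if also $f_i\le f_{i-1}$, then $A$ fails the Weak Lefschetz Property in degree $i$. (2) If $\delta$ is injective (for example if $H_i(\Delta(i),\mathbb{Z}/2)=0$), then $\mu_\ell:A_i\to A_{i+1}$ is surjective and the Weak Lefschetz Property holds for $A$ in degree $i$.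
   Context: Since $A$ is Artinian, $I=J'+J_\Delta$ where $J'=\langle x_0^2,\ldots,x_r^2\rangle$ and $J_\Delta$, generated by squarefree quadratic monomials, is the Stanley–Reisner ideal of a flag simplicial complex $\Delta$ on the vertices corresponding to $x_0,\ldots,x_r$. $f_j=f_j(\Delta)$ is the number of $j$-dimensional faces of $\Delta$, with $f_{-1}=1$; thus $\dim A_i=f_{i-1}$. $\Delta(i)$ is obtained from $\Delta$ by deleting all faces of dimension $\ge i+1$; algebraically this replaces $I$ by $I(i)=I+\langle S_{i+2}\rangle$, where $S$ is the polynomial ring. Homology is reduced simplicial homology (this matters only for $i=0$), so $H_i(\Delta(i),\mathbb{Z}/2)=\ker\partial_i$, where $\partial_i$ is the (augmented) simplicial boundary map from $i$-chains to $(i-1)$-chains of $\Delta(i)$ with $\mathbb{Z}/2$ coefficients. $A$ has (resp. fails) the Weak Lefschetz Property (WLP) in degree $i$ if for a general linear form the multiplication map $A_i\to A_{i+1}$ has (resp. does not have) maximal rank; for monomial quotients the form $\ell=x_0+\cdots+x_r$ is general. Definition of $\delta$: let $B=\mathbb{Z}[x_0,\ldots,x_r]/I(i)$, with $I(i)$ the ideal generated by the same monomials over $\mathbb{Z}$. Its graded pieces are free $\mathbb{Z}$-modules. Let $\mu_\ell^\vee:B_{i+1}^\vee\to B_i^\vee$ be the $\mathbb{Z}$-dual of multiplication by $\ell$ on $B$, $B_i\to B_{i+1}$. Its reduction mod $2$ is $\partial_i:B_{i+1}^\vee\otimes\mathbb{Z}/2\to B_i^\vee\otimes\mathbb{Z}/2$.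 Tensoring $0\to\mathbb{Z}\xrightarrow{\cdot 2}\mathbb{Z}\to\mathbb{Z}/2\to0$ with $\mu_\ell^\vee$ and applying the snake lemma yields the exact sequence $$0\to\ker(\mu_\ell^\vee)\xrightarrow{\cdot2}\ker(\mu_\ell^\vee)\to H_i(\Delta(i),\mathbb{Z}/2)\xrightarrow{\ \delta\ }\mathrm{coker}(\mu_\ell^\vee)\xrightarrow{\cdot2}\mathrm{coker}(\mu_\ell^\vee)\to\mathrm{coker}(\partial_i)\to0,$$ where $\delta$ is the connecting homomorphism. *)

(* Defs.v *)
From HB Require Import structures.
From mathcomp Require Import all_boot all_order all_algebra.
From mathcomp Require Import mpoly.
From mathcomp Require Import boolp classical_sets functions.

Set Implicit Arguments.
Unset Strict Implicit.
Unset Printing Implicit Defensive.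

Import GRing.Theory.

Local Open Scope ring_scope.
Local Open Scope quotient_scope.

Definition surjective (S T : Type) (f : S -> T) := forall y, exists x, f x = y.

Section MonomialIdeal.
Variables (R : comNzRingType) (n : nat).

Definition mon_ideal (M : pred 'X_{1..n}) : {pred {mpoly R[n]}} := fun p =>
  `[< exists2 s : seq ({mpoly R[n]} * 'X_{1..n}),
        all (fun cm => M cm.2) s & p = \sum_(cm <- s) cm.1 * 'X_[cm.2] >].

End MonomialIdeal.

(* Sets of monomials of positive degree: those generating a proper ideal. *)
Record posmon n := PosMon {
  pos_gens :> pred 'X_{1..n};
  pos_gensP : forall m, pos_gens m -> (0 < mdeg m)%N }.

Record quadmon n := QuadMon {
  quad_gens :> pred 'X_{1..n};
  quad_gensP : forall m, quad_gens m -> mdeg m = 2%N }.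

Lemma quad_pos_subproof n (G : quadmon n) m : G m -> (0 < mdeg m)%N.
Proof. by move=> /quad_gensP ->. Qed.

Definition quad_pos n (G : quadmon n) : posmon n :=
  PosMon (@quad_pos_subproof n G).

Lemma trunc_gens_subproof n (G : quadmon n) i m :
  G m || (mdeg m == i.+2) -> (0 < mdeg m)%N.
Proof. by case/orP => [/quad_gensP ->|/eqP ->]. Qed.

(* Generators of I(i) = I + <S_(i+2)>; the ideal <S_(i+2)> is generated by the
   monomials of degree i+2. *)
Definition trunc_gens n (G : quadmon n) i : posmon n :=
  PosMon (@trunc_gens_subproof n G i).

Section Quotient.
Variables (R : comNzRingType) (n : nat) (M : posmon n).

Lemma mon_ideal_closed : idealr_closed (mon_ideal (R := R) M).
Proof.
split.
- by apply/asboolP; exists [::]; rewrite ?big_nil.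
- apply/negP => /asboolP[s sM /(congr1 (mcoeff 0%MM))].
  rewrite mcoeff1 eqxx raddf_sum /= big_seq big1 => [/eqP|cm cms].
    by rewrite oner_eq0.
  have Mcm : M cm.2 by exact: (allP sM).
  have /= := (rmorphM (mcoeff (R := R) (0%MM : 'X_{1..n}))) cm.1 'X_[cm.2] => ->.
  rewrite mcoeffX; case: eqP => [m0|]; last by rewrite mulr0.
  by have := pos_gensP Mcm; rewrite m0 mdeg0.
- move=> a u v /asboolP[s sM ->] /asboolP[t tM ->].
  apply/asboolP; exists ([seq (a * cm.1, cm.2) | cm <- s] ++ t).
    by rewrite all_cat all_map tM andbT.
  rewrite big_cat big_map /= mulr_sumr; congr (_ + _).
  by apply: eq_bigr => cm _; rewrite mulrA.
Qed.

HB.instance Definition _ :=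
  isIdealr.Build {mpoly R[n]} (mon_ideal (R := R) M) mon_ideal_closed.

Definition mon_quot :=
  @Quotient.quot {mpoly R[n]} (mon_ideal (R := R) M).

HB.instance Definition _ := GRing.ComNzRing.on mon_quot.

(* The graded piece of degree d: classes of forms of degree d. *)
Definition in_degree (d : nat) : pred mon_quot := fun b =>
  `[< exists2 p : {mpoly R[n]}, p \is d.-homog & b = \pi_mon_quot p >].

Lemma in_degree_closed d : zmod_closed (in_degree d).
Proof.
split; first by apply/asboolP; exists 0; rewrite ?rpred0 ?raddf0.
move=> _ _ /asboolP[p hp ->] /asboolP[q hq ->]; apply/asboolP.
by exists (p - q); rewrite ?rpredB ?raddfB.
Qed.

HB.instance Definition _ d :=
  GRing.isZmodClosed.Build mon_quot (in_degree d) (in_degree_closed d).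

Record grpiece (d : nat) :=
  GrPiece { gr_val :> mon_quot; gr_valP : gr_val \in in_degree d }.

HB.instance Definition _ d := [isSub for @gr_val d].
HB.instance Definition _ d := [Choice of grpiece d by <:].
HB.instance Definition _ d := [SubChoice_isSubZmodule of grpiece d by <:].

Definition linform (a : 'I_n -> R) : {mpoly R[n]} := \sum_j a j *: 'X_j.

Lemma linform_homog a : linform a \is 1.-homog.
Proof. by apply: rpred_sum => j _; rewrite rpredZ // dhomogX /= mdeg1. Qed.

Lemma mul_linform_subproof a d (b : grpiece d) :
  \pi_mon_quot (linform a) * gr_val b \in in_degree d.+1.
Proof.
have /asboolP[p hp ->] := gr_valP b; apply/asboolP.
exists (linform a * p); last by rewrite rmorphM.
by rewrite -add1n dhomogM // linform_homog.
Qed.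

Definition mul_linform a d (b : grpiece d) : grpiece d.+1 :=
  GrPiece (mul_linform_subproof a b).

Lemma mul_linform_is_zmod_morphism a d : zmod_morphism (@mul_linform a d).
Proof. by move=> x y; apply: val_inj; rewrite /= mulrBr. Qed.

HB.instance Definition _ a d :=
  GRing.isZmodMorphism.Build (grpiece d) (grpiece d.+1) (@mul_linform a d)
    (@mul_linform_is_zmod_morphism a d).

(* Multiplication by l = x_0 + ... + x_r. *)
Definition mul_ell d : grpiece d -> grpiece d.+1 := @mul_linform (fun=> 1) d.

HB.instance Definition _ d :=
  GRing.isZmodMorphism.Build (grpiece d) (grpiece d.+1) (@mul_ell d)
    (@mul_linform_is_zmod_morphism (fun=> 1) d).

End Quotient.

Section Artinian.
Variable A : comNzRingType.

Definition is_ideal (J : A -> Prop) :=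
  [/\ J 0, forall x y, J x -> J y -> J (x + y) & forall a x, J x -> J (a * x)].

Definition artinian := forall J : nat -> A -> Prop,
  (forall k, is_ideal (J k)) -> (forall k x, J k.+1 x -> J k x) ->
  exists N, forall k, (N <= k)%N -> forall x, J k x <-> J N x.

End Artinian.

Section WLP.
Variables (K : fieldType) (n : nat) (M : posmon n) (d : nat).

(* P holds for a general linear form \sum_j a_j x_j: on a nonempty
   (principal) Zariski open set of coefficient vectors a. *)
Definition generically (P : ('I_n -> K) -> Prop) :=
  exists2 F : {mpoly K[n]}, F != 0 & forall a, F.@[a] != 0 -> P a.

Definition maximal_rank (a : 'I_n -> K) :=
  injective (@mul_linform K n M a d) \/ surjective (@mul_linform K n M a d).

Definition has_WLP := generically maximal_rank.
Definition fails_WLP := generically (fun a => ~ maximal_rank a).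

End WLP.

Section Complex.
Variable n : nat.
Implicit Types (F : {set 'I_n}) (D : {set {set 'I_n}}).

Definition setmon F : 'X_{1..n} := [multinom (j \in F : nat) | j < n].

Definition squarefree (m : 'X_{1..n}) := [forall j, (m j <= 1)%N].

(* The complex whose Stanley-Reisner ideal is J_Delta, the ideal of K[x]
   generated by the squarefree elements of G. *)
Definition flag_complex (K : fieldType) (G : quadmon n) : {set {set 'I_n}} :=
  [set F | ('X_[setmon F] : {mpoly K[n]})
             \notin mon_ideal (R := K) [pred m | G m && squarefree m]].

Definition fdim F : int := #|F|%:Z - 1.

Definition fvec D (j : int) : nat := #|[set F in D | fdim F == j]|.

Definition skeleton D (i : nat) := [set F in D | ~~ (i.+1%:Z <= fdim F)].

Definition face D (j : int) := {F : {set 'I_n} | (F \in D) && (fdim F == j)}.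

Definition chain D (j : int) := {ffun face D j -> 'F_2}.
HB.instance Definition _ D j := GRing.Zmodule.on (chain D j).

(* The face F maps to the sum over v in F of F :\ v. *)
Definition boundary D (j : int) (z : chain D j) : chain D (j - 1) :=
  [ffun H : face D (j - 1) =>
    \sum_(F : face D j) \sum_(v in val F | val F :\ v == val H) z F].

Lemma boundary_is_zmod_morphism D j : zmod_morphism (@boundary D j).
Proof.
move=> y z; apply/ffunP => H; rewrite !ffunE -sumrB.
by apply: eq_bigr => F _; rewrite -sumrB; apply: eq_bigr => v _; rewrite !ffunE.
Qed.

HB.instance Definition _ D j :=
  GRing.isZmodMorphism.Build (chain D j) (chain D (j - 1)) (@boundary D j)
    (@boundary_is_zmod_morphism D j).

(* H_i(Delta(i), Z/2): there are no boundaries, as Delta(i) has no faces of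
   dimension i+1. *)
Definition is_cycle D i : pred (chain (skeleton D i) i) :=
  fun z => boundary z == 0.

Lemma is_cycle_closed D i : zmod_closed (@is_cycle D i).
Proof.
split=> [|y z]; rewrite !unfold_in /is_cycle ?raddf0 //.
by rewrite raddfB /= => /eqP-> /eqP->; rewrite subrr.
Qed.

HB.instance Definition _ D i :=
  GRing.isZmodClosed.Build (chain (skeleton D i) i) (@is_cycle D i)
    (@is_cycle_closed D i).

Record top_homology D i := TopHomology {
  cycle_of :> chain (skeleton D i) i; cycle_ofP : cycle_of \in @is_cycle D i }.

HB.instance Definition _ D i := [isSub for @cycle_of D i].
HB.instance Definition _ D i := [Choice of top_homology D i by <:].
HB.instance Definition _ D i := [SubChoice_isSubZmodule of top_homology D i by <:].

End Complex.

Section Dual.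

Definition is_dual (M : zmodType) : pred (M -> int) :=
  fun f => `[< zmod_morphism f >].

Lemma is_dual_closed M : zmod_closed (@is_dual M).
Proof.
split; first by apply/asboolP => x y; rewrite subrr.
move=> f g /asboolP hf /asboolP hg; apply/asboolP => x y.
by rewrite /= !fctE hf hg !opprD !opprK addrACA.
Qed.

HB.instance Definition _ (M : zmodType) :=
  GRing.isZmodClosed.Build (M -> int) (@is_dual M) (@is_dual_closed M).

Record dual (M : zmodType) :=
  Dual { dual_fun :> M -> int; dual_funP : dual_fun \in @is_dual M }.

HB.instance Definition _ (M : zmodType) := [isSub for @dual_fun M].
HB.instance Definition _ (M : zmodType) := [Choice of dual M by <:].
HB.instance Definition _ (M : zmodType) := [SubChoice_isSubZmodule of dual M by <:].

Variables (M N : zmodType) (f : {additive M -> N}).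

Lemma dual_map_subproof (phi : dual N) : phi \o f \in @is_dual M.
Proof.
have /asboolP hphi := dual_funP phi.
by apply/asboolP => x y; rewrite /= raddfB hphi.
Qed.

Definition dual_map (phi : dual N) : dual M := Dual (dual_map_subproof phi).

Lemma dual_map_is_zmod_morphism : zmod_morphism dual_map.
Proof. by move=> phi psi; apply: val_inj. Qed.

HB.instance Definition _ :=
  GRing.isZmodMorphism.Build (dual N) (dual M) dual_map dual_map_is_zmod_morphism.

End Dual.

Section Coker.
Variables (M N : zmodType) (f : {additive M -> N}).

Definition in_image : {pred N} := fun y => `[< exists x, y = f x >].

Lemma in_image_closed : zmod_closed in_image.
Proof.
split; first by apply/asboolP; exists 0; rewrite raddf0.
move=> _ _ /asboolP[x ->] /asboolP[y ->]; apply/asboolP.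
by exists (x - y); rewrite raddfB.
Qed.

HB.instance Definition _ := GRing.isZmodClosed.Build N in_image in_image_closed.

Definition coker := @Quotient.quot N in_image.

HB.instance Definition _ := GRing.Zmodule.on coker.
HB.instance Definition _ := Quotient.on coker.

End Coker.

Section Delta.
Variables (K : fieldType) (n : nat) (G : quadmon n) (i : nat).

Local Notation Delta := (flag_complex K G).
Local Notation B := (grpiece int (trunc_gens G i)).

(* mu_l^\vee : B_(i+1)^\vee -> B_i^\vee *)
Definition mu_dual : dual (B i.+1) -> dual (B i) :=
  dual_map (@mul_ell int n (trunc_gens G i) i).

HB.instance Definition _ :=
  GRing.isZmodMorphism.Build (dual (B i.+1)) (dual (B i)) mu_dual
    (dual_map_is_zmod_morphism (@mul_ell int n (trunc_gens G i) i)).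

Lemma mdeg_setmon (F : {set 'I_n}) : mdeg (setmon F) = #|F|.
Proof.
rewrite mdegE -sum1_card [RHS]big_mkcond; apply: eq_bigr => j _.
by rewrite mnmE; case: (j \in F).
Qed.

Lemma face_class_subproof (F : face (skeleton Delta i) i) :
  \pi_(mon_quot int (trunc_gens G i)) 'X_[setmon (val F)]
    \in in_degree i.+1.
Proof.
apply/asboolP; exists 'X_[setmon (val F)] => //.
rewrite dhomogX /= mdeg_setmon.
by have /andP[_ /eqP/(canRL (subrK _))/eqP] := valP F; rewrite addrC.
Qed.

Definition face_class (F : face (skeleton Delta i) i) : B i.+1 :=
  GrPiece (face_class_subproof F).

(* Reduction mod 2, B_(i+1)^\vee -> B_(i+1)^\vee (x) Z/2 = C_i(Delta(i), Z/2):
   the monomials x^F, F a face of dimension i, form a basis of B_(i+1). *)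
Definition mod2 (phi : dual (B i.+1)) : chain (skeleton Delta i) i :=
  [ffun F => (phi (face_class F))%:~R].

(* Snake lemma: delta z is the class of psi, where 2 psi = mu_l^\vee phi for a
   lift phi of the cycle z.  Such phi and psi exist, and the class does not
   depend on them, as soon as G contains all the squares x_j^2; this holds when
   the quotient by the ideal of G is Artinian. *)
Definition delta (z : top_homology Delta i) : coker mu_dual :=
  \pi_(coker mu_dual) (xget 0 (fun psi : dual (B i) =>
    exists2 phi, mod2 phi = z & mu_dual phi = psi *+ 2)).

End Delta.

(* Main.v *)
(* The monomials outside I of degrees i and i+1 correspond to faces of Delta, and
   in these bases mu is given, over K as over Z, by the incidence matrix W of the
   i-faces (rows) and their facets (columns).  The connecting map delta is
   injective iff every element of ker(mu_l^\vee) is twice an element of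
   ker(mu_l^\vee), that is, by infinite descent, iff ker(mu_l^\vee) = 0: no
   integral relation holds between the rows of W.  In that case W has a right
   inverse over Z up to a nonzero integer, which is invertible in K, so mu is
   surjective over K; conversely an integral relation between the rows obstructs
   surjectivity.  Rescaling the variables transports all this from l to every
   linear form with nonzero coefficients, which is a general one. *)
From HB Require Import structures.
Require Import Defs.
From mathcomp Require Import all_boot all_order all_algebra.
From mathcomp Require Import mpoly.
From mathcomp Require Import zify.
From mathcomp Require Import boolp classical_sets functions.
Import GRing.Theory Num.Theory.
Local Open Scope ring_scope.
Local Open Scope quotient_scope.

Set Implicit Arguments.
Unset Strict Implicit.
Unset Printing Implicit Defensive.

(** * Linear systems over a field and over the integers *)

Lemma common_denominator (I : finType) (x : I -> rat) :
  exists2 N : int, N != 0 & exists y : I -> int, forall k, (y k)%:~R = N%:~R * x k.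
Proof.
exists (\prod_k denq (x k)); first by apply/prodf_neq0 => k _; exact: denq_neq0.
exists (fun k => numq (x k) * \prod_(j | j != k) denq (x j)) => k.
by rewrite [in RHS](bigD1 k) //= !intrM [RHS]mulrC mulrA -numqE.
Qed.

Section LinearSystems.
Variables S T : finType.

Section Matrix.
Variables (F : fieldType) (w : S -> T -> F).

Let A : 'M[F]_(#|S|, #|T|) := \matrix_(j, k) w (enum_val j) (enum_val k).

Let mulA_rowE (x : S -> F) t :
  ((\row_j x (enum_val j)) *m A) 0 (enum_rank t) = \sum_s x s * w s t.
Proof.
rewrite mxE (reindex (@enum_val S predT)) /=.
  by apply: eq_bigr => j _; rewrite !mxE enum_rankK.
exact: onW_bij (enum_val_bij S).
Qed.

Lemma injective_row_free :
  (forall x : S -> F, (forall t, \sum_s x s * w s t = 0) -> forall s, x s = 0) ->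
  row_free A.
Proof.
move=> inj; apply: inj_row_free => v vA0; apply/rowP => j.
rewrite mxE -[j]enum_valK; apply: (inj (fun s => v 0 (enum_rank s))) => t.
rewrite -mulA_rowE; have -> : \row_k v 0 (enum_rank (enum_val k)) = v.
  by apply/rowP => k; rewrite mxE enum_valK.
by rewrite vA0 mxE.
Qed.

Lemma injective_left_inverse :
  (forall x : S -> F, (forall t, \sum_s x s * w s t = 0) -> forall s, x s = 0) ->
  exists v : T -> S -> F, forall s s', \sum_t w s t * v t s' = (s == s')%:R.
Proof.
move=> /injective_row_free/row_freeP[B AB].
exists (fun t s => B (enum_rank t) (enum_rank s)) => s s'.
have := congr1 (fun X : 'M_#|S| => X (enum_rank s) (enum_rank s')) AB.
rewrite !mxE (inj_eq enum_rank_inj) => <-.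
rewrite (reindex (@enum_val T predT)) /=.
  by apply: eq_bigr => k _; rewrite !mxE enum_rankK enum_valK.
exact: onW_bij (enum_val_bij T).
Qed.

(** Freeness gives rank [#|S|], and the rank is at most [#|T|], so the inequality forces full column
    rank. This is the dimension count that excludes injectivity when f_i <= f_(i-1). *)
Lemma injective_surjective : (#|T| <= #|S|)%N ->
  (forall x : S -> F, (forall t, \sum_s x s * w s t = 0) -> forall s, x s = 0) ->
  forall y : T -> F, exists x : S -> F, forall t, \sum_s x s * w s t = y t.
Proof.
move=> TS /injective_row_free freeA y.
have fullA : row_full A.
  by rewrite /row_full eqn_leq rank_leq_col (eqP freeA).
have /submxP[D yD] := submx_full (\row_k y (enum_val k)) fullA.
exists (fun s => D 0 (enum_rank s)) => t.
rewrite -mulA_rowE; have -> : \row_j D 0 (enum_rank (enum_val j)) = D.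
  by apply/rowP => j; rewrite mxE enum_valK.
by rewrite -yD mxE enum_rankK.
Qed.

End Matrix.
End LinearSystems.

(** Clearing denominators serves twice: it turns a rational kernel vector into an integral one, so
    injectivity passes to the rationals, and it makes the rational inverse integral up to the factor
    [N]. *)
Lemma int_injective_left_inverse (S T : finType) (w : S -> T -> int) :
  (forall x : S -> int,
     (forall t, \sum_s x s * w s t = 0) -> forall s, x s = 0) ->
  exists2 N : int, N != 0 & exists v : T -> S -> int,
    forall s s', \sum_t w s t * v t s' = N * (s == s')%:R.
Proof.
move=> inj.
have [x x0|v vP] := @injective_left_inverse S T rat (fun s t => (w s t)%:~R).
  have [N N0 [y yP]] := common_denominator x.
  move=> s; apply: (mulfI (_ : N%:~R != 0)); first by rewrite intr_eq0.
  rewrite mulr0 -yP inj // => t; apply/eqP.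
  rewrite -(intr_eq0 rat) rmorph_sum /=.
  under eq_bigr do rewrite intrM yP -mulrA.
  by rewrite -mulr_sumr x0 mulr0.
have [N N0 [y yP]] := common_denominator (fun ts => v ts.1 ts.2).
exists N => //; exists (fun t s => y (t, s)) => s s'; apply: (@intr_inj rat).
rewrite rmorph_sum intrM /= rmorph_nat -vP mulr_sumr.
by apply: eq_bigr => t _; rewrite intrM yP mulrCA.
Qed.

(** * Normal monomials and coordinates on graded pieces *)

Section NormalMonomials.
Variables (R : comNzRingType) (n : nat).

(** Also known as standard monomials: those outside the ideal generated by [M], whose classes form a
    basis of the quotient. *)
Definition normal (M : pred 'X_{1..n}) (m : 'X_{1..n}) :=
  forall g, M g -> ~~ (g <= m)%MM.

Lemma normalW (M : pred 'X_{1..n}) m m' :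
  (m <= m')%MM -> normal M m' -> normal M m.
Proof. by move=> mm' nm' g /nm'; apply: contra => /lepm_trans; apply. Qed.

Lemma mcoeffMX_nle (p : {mpoly R[n]}) g m :
  ~~ (g <= m)%MM -> (p * 'X_[g])@_m = 0.
Proof.
move=> gm; apply: memN_msupp_eq0; rewrite (perm_mem (msuppMX p g)).
by apply: contra gm => /mapP[k _ ->]; exact: lem_addr.
Qed.

Lemma mon_idealP (M : pred 'X_{1..n}) (p : {mpoly R[n]}) :
  reflect (forall m, normal M m -> p@_m = 0) (p \in mon_ideal M).
Proof.
apply: (iffP idP) => [/asboolP[s sM ->] m nm|p0].
  rewrite raddf_sum big_seq big1 // => cg /(allP sM) /nm.
  exact: mcoeffMX_nle.
(* Each monomial of the support gets a generator dividing it; off the support the value [0%MM] is a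
   mere default. *)
apply/asboolP; have /choice[g gP] m : exists g, m \in msupp p -> M g /\ (g <= m)%MM.
  have [mp|_] := boolP (m \in msupp p); last by exists 0%MM.
  have [[g gP]|ng] := pselect (exists g, M g /\ (g <= m)%MM); first by exists g.
  move: mp; rewrite mcoeff_msupp p0 ?eqxx // => g Mg; apply/negP => gm.
  by apply: ng; exists g.
exists [seq (p@_m *: 'X_[m - g m], g m) | m <- msupp p].
  by rewrite all_map; apply/allP => m /gP[].
rewrite big_map [LHS]mpolyE big_seq [RHS]big_seq; apply: eq_bigr => m /gP[_ gm].
by rewrite /= -scalerAl -mpolyXD submK.
Qed.

End NormalMonomials.

Section Coordinates.
Variables (R : comNzRingType) (n : nat) (M : posmon n).
Implicit Types (d : nat) (m : 'X_{1..n}) (a : 'I_n -> R).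

(** Meaningful for normal [m] only: elements of the ideal have no coefficient there, so the choice
    made by [repr] does not matter. *)
Definition coord d (b : grpiece R M d) m : R := (repr (gr_val b))@_m.

Lemma mcoeff_repr_pi (p : {mpoly R[n]}) m : normal M m ->
  (repr (\pi_(mon_quot R M) p))@_m = p@_m.
Proof.
move=> nm; apply/eqP; rewrite -subr_eq0 -mcoeffB; apply/eqP.
have : repr (\pi_(mon_quot R M) p) - p \in mon_ideal M.
  by rewrite Quotient.idealrBE reprK.
by move/mon_idealP; apply.
Qed.

Lemma coordE d (b : grpiece R M d) p m : normal M m ->
  gr_val b = \pi_(mon_quot R M) p -> coord b m = p@_m.
Proof. by rewrite /coord => nm ->; exact: mcoeff_repr_pi. Qed.

Lemma grpiece_repr d (b : grpiece R M d) :
  exists2 p, p \is d.-homog & gr_val b = \pi_(mon_quot R M) p.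
Proof. exact/asboolP/gr_valP. Qed.

(** Homogeneous representatives have no coefficients outside degree [d], so their difference
    vanishes at every normal monomial and lies in the ideal. *)
Lemma eq_coord d (b b' : grpiece R M d) :
  (forall m, normal M m -> mdeg m = d -> coord b m = coord b' m) -> b = b'.
Proof.
have [p hp bp] := grpiece_repr b; have [q hq bq] := grpiece_repr b'.
move=> eqb; apply: val_inj; rewrite /= bp bq; apply/eqP.
rewrite -Quotient.idealrBE; apply/mon_idealP => m nm; rewrite mcoeffB.
have [md|/eqP md] := eqVneq (mdeg m) d.
  by rewrite -(coordE nm bp) -(coordE nm bq) eqb // subrr.
by rewrite (dhomog_nemf_coeff hp) ?(dhomog_nemf_coeff hq) ?subrr //; apply/eqP.
Qed.

Lemma coordB d m : normal M m ->
  {morph @coord d ^~ m : b b' / b - b'}.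
Proof.
move=> nm b b'; have [p hp bp] := grpiece_repr b.
have [q hq bq] := grpiece_repr b'.
rewrite (coordE nm bp) (coordE nm bq) -mcoeffB; apply: coordE => //.
by rewrite /= bp bq raddfB.
Qed.

Lemma coord_mul_linform a d (b : grpiece R M d) m : normal M m ->
  coord (mul_linform a b) m =
  \sum_j (if (U_(j) <= m)%MM then a j * coord b (m - U_(j))%MM else 0).
Proof.
move=> nm; have [p hp bp] := grpiece_repr b.
rewrite (@coordE _ _ (linform a * p)) //=; last by rewrite bp rmorphM.
rewrite mulr_suml raddf_sum; apply: eq_bigr => j _.
rewrite /= -scalerAl mcoeffZ [_ * p]mulrC.
case: ifP => jm; last by rewrite mcoeffMX_nle ?jm // mulr0.
rewrite -{1}(submK jm) addmC mcoeffMX (coordE _ bp) //.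
exact: normalW (lem_subr _ _) nm.
Qed.

End Coordinates.

(** Stated for a bare function so as to cover both coordinates and elements of a dual. *)
Lemma zmod_morphism_comb (V W : zmodType) (f : V -> W) (T : finType)
    (b : T -> V) (c : T -> int) : zmod_morphism f ->
  f (\sum_t b t *~ c t) = \sum_t f (b t) *~ c t.
Proof.
move=> fB; pose F : {additive V -> W} :=
  HB.pack f (GRing.isZmodMorphism.Build V W f fB).
rewrite -[f]/(F : V -> W) raddf_sum; apply: eq_bigr => t _.
exact: raddfMz.
Qed.

(** * Monomial bases and the matrix of multiplication by a linear form *)

Section Bases.
Variable n : nat.

(** A monomial basis of the graded piece. The index type is abstract so that the same faces can
    index bases over [K] modulo I and over the integers modulo I(i). *)
Record enumerates (M : pred 'X_{1..n}) d (T : finType) (mt : T -> 'X_{1..n}) :=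
  Enumerates {
    enum_inj : injective mt;
    enum_normal : forall t, normal M (mt t);
    enum_mdeg : forall t, mdeg (mt t) = d;
    enum_surj : forall m, normal M m -> mdeg m = d -> exists t, m = mt t }.

(** The matrix of multiplication by the form with coefficients [a]; the sum has at most one term. *)
Definition incidence (R : comNzRingType) (S T : finType)
    (ms : S -> 'X_{1..n}) (mt : T -> 'X_{1..n}) (a : 'I_n -> R) s t : R :=
  \sum_(j | mt t == (ms s + U_(j))%MM) a j.

Lemma incidence_rmorph (R R' : comNzRingType) (f : {rmorphism R -> R'})
    (S T : finType) (ms : S -> 'X_{1..n}) (mt : T -> 'X_{1..n}) s t :
  incidence ms mt (fun=> 1) s t = f (incidence ms mt (fun=> 1) s t).
Proof. by rewrite rmorph_sum; apply: eq_bigr => j _; rewrite rmorph1. Qed.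

(* Rescaling the variables by [a] turns the form [\sum_j a_j x_j] into [l]. *)
Lemma incidence_scale (R : comNzRingType) (S T : finType)
    (ms : S -> 'X_{1..n}) (mt : T -> 'X_{1..n}) (a : 'I_n -> R) s t :
  'X_[ms s].@[a] * incidence ms mt a s t =
  'X_[mt t].@[a] * incidence ms mt (fun=> 1) s t.
Proof.
rewrite !mulr_sumr; apply: eq_bigr => j /eqP ->.
by rewrite mpolyXD mevalM mevalXU mulr1.
Qed.

Section Coordinates.
Variables (R : comNzRingType) (M : posmon n).

Lemma eq_coord_enum d (T : finType) (mt : T -> 'X_{1..n})
    (eT : enumerates M d mt) (b b' : grpiece R M d) :
  (forall t, coord b (mt t) = coord b' (mt t)) -> b = b'.
Proof.
by move=> eqb; apply: eq_coord => m nm /(enum_surj eT nm)[t ->].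
Qed.

Lemma coord_surj d (T : finType) (mt : T -> 'X_{1..n})
    (eT : enumerates M d mt) (c : T -> R) :
  exists b : grpiece R M d, forall t, coord b (mt t) = c t.
Proof.
have cP : \pi_(mon_quot R M) (\sum_t c t *: 'X_[mt t]) \in in_degree d.
  apply/asboolP; eexists; last by [].
  apply: rpred_sum => t _; rewrite rpredZ // dhomogX; apply/eqP.
  exact: (enum_mdeg eT).
exists (GrPiece cP) => t; rewrite (@coordE _ _ _ _ _ (\sum_t c t *: 'X_[mt t])) //.
  rewrite raddf_sum (bigD1 t) //= mcoeffZ mcoeffX eqxx mulr1.
  rewrite big1 ?addr0 // => t' t't.
  by rewrite mcoeffZ mcoeffX (inj_eq (enum_inj eT)) (negPf t't) mulr0.
exact: (enum_normal eT).
Qed.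

Variables (d : nat) (S T : finType).
Variables (ms : S -> 'X_{1..n}) (mt : T -> 'X_{1..n}).
Hypotheses (eS : enumerates M d ms) (eT : enumerates M d.+1 mt).

Lemma coord_mul_enum a (b : grpiece R M d) t :
  coord (mul_linform a b) (mt t) =
  \sum_s coord b (ms s) * incidence ms mt a s t.
Proof.
rewrite coord_mul_linform; last exact: enum_normal eT t.
under [RHS]eq_bigr do rewrite mulr_sumr big_mkcond.
rewrite exchange_big; apply: eq_bigr => j _; rewrite -big_mkcond /=.
case: ifPn => [jt|jt]; last first.
  by rewrite big1 // => s /eqP ts; move: jt; rewrite ts lem_addl.
(* Dividing a normal monomial by x_j leaves a normal monomial of degree [d], so exactly one index
   [s] contributes for this [j]. *)
have [||s sP] := enum_surj eS (m := (mt t - U_(j))%MM).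
- exact: normalW (lem_subr _ _) (enum_normal eT t).
- have := congr1 (@mdeg n) (submK jt).
  by rewrite mdegD mdeg1 addn1 (enum_mdeg eT) => -[].
rewrite sP mulrC (big_pred1 s) // => s'.
by rewrite -{1}(submK jt) sP /= eqm_add2r (inj_eq (enum_inj eS)) eq_sym.
Qed.

Lemma surjective_mul_linform a : surjective (@mul_linform R n M a d) <->
  forall y : T -> R, exists x : S -> R,
    forall t, \sum_s x s * incidence ms mt a s t = y t.
Proof.
split=> [sur y|sur b'].
  have [b' b'P] := coord_surj eT y; have [b bP] := sur b'.
  by exists (fun s => coord b (ms s)) => t; rewrite -coord_mul_enum bP.
have [x xP] := sur (fun t => coord b' (mt t)).
have [b bP] := coord_surj eS x.
exists b; apply: (eq_coord_enum eT) => t; rewrite coord_mul_enum -xP.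
by apply: eq_bigr => s _; rewrite bP.
Qed.

Lemma injective_mul_linform a : injective (@mul_linform R n M a d) ->
  forall x : S -> R, (forall t, \sum_s x s * incidence ms mt a s t = 0) ->
  forall s, x s = 0.
Proof.
move=> inj x x0 s; have [b bP] := coord_surj eS x.
have coord0 d' m : normal M m -> coord (0 : grpiece R M d') m = 0.
  by move=> nm; rewrite -[0 in LHS](subrr 0) coordB // subrr.
suff b0 : b = 0 by rewrite -bP b0 coord0 //; exact: enum_normal eS s.
apply: inj; apply: (eq_coord_enum eT) => t.
rewrite raddf0 coord0; last exact: enum_normal eT t.
by rewrite coord_mul_enum -[RHS](x0 t); apply: eq_bigr => s' _; rewrite bP.
Qed.

End Coordinates.

Section DualBasis.
Variables (M : posmon n) (d : nat) (T : finType) (mt : T -> 'X_{1..n}).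
Hypothesis eT : enumerates M d mt.
Implicit Types phi psi : dual (grpiece int M d).

Lemma monomial_class_subproof t :
  \pi_(mon_quot int M) 'X_[mt t] \in in_degree d.
Proof.
apply/asboolP; exists 'X_[mt t] => //.
by rewrite dhomogX; apply/eqP; exact: enum_mdeg eT t.
Qed.

Definition monomial_class t : grpiece int M d :=
  GrPiece (monomial_class_subproof t).

Lemma coord_monomial_class t t' : coord (monomial_class t) (mt t') = (t == t')%:R.
Proof.
rewrite (@coordE _ _ _ _ _ 'X_[mt t]) //; last exact: enum_normal eT t'.
by rewrite mcoeffX (inj_eq (enum_inj eT)).
Qed.

Lemma dual_zmod_morphism phi : zmod_morphism phi.
Proof. exact/asboolP/dual_funP. Qed.

Lemma grpiece_decomp (b : grpiece int M d) :
  b = \sum_t monomial_class t *~ coord b (mt t).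
Proof.
apply: (eq_coord_enum eT) => t.
rewrite (@zmod_morphism_comb _ _ (@coord _ _ _ d ^~ (mt t))); last first.
  by move=> ? ?; apply: coordB; exact: enum_normal eT t.
rewrite (bigD1 t) //= coord_monomial_class eqxx big1 ?addr0 ?intz //.
by move=> t' t't; rewrite coord_monomial_class (negPf t't) mul0rz.
Qed.

Lemma dual_decomp phi b :
  phi b = \sum_t phi (monomial_class t) * coord b (mt t).
Proof.
rewrite {1}[b]grpiece_decomp zmod_morphism_comb; last exact: dual_zmod_morphism.
by apply: eq_bigr => t _; rewrite -mulrzr intz.
Qed.

Lemma eq_dual phi psi :
  (forall t, phi (monomial_class t) = psi (monomial_class t)) -> phi = psi.
Proof.
move=> eqphi; apply: val_inj; apply: funext => b /=.
by rewrite !dual_decomp; apply: eq_bigr => t _; rewrite eqphi.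
Qed.

Lemma dual_surj (x : T -> int) : exists phi, forall t, phi (monomial_class t) = x t.
Proof.
have xP : (fun b : grpiece int M d => \sum_t x t * coord b (mt t)) \in is_dual (M := _).
  apply/asboolP => b b'; rewrite -sumrB; apply: eq_bigr => t _.
  by rewrite coordB ?mulrBr //; exact: enum_normal eT t.
exists (Dual xP) => t; rewrite /= (bigD1 t) //= coord_monomial_class eqxx mulr1.
rewrite big1 ?addr0 // => t' t't.
by rewrite coord_monomial_class eq_sym (negPf t't) mulr0.
Qed.

End DualBasis.
End Bases.

(** * Integral relations and surjectivity in characteristic zero *)

(** In dual bases, the vanishing of ker(mu_l^\vee). *)
Definition int_kernel0 n (S T : finType) (ms : S -> 'X_{1..n})
    (mt : T -> 'X_{1..n}) := forall x : T -> int,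
  (forall s, \sum_t x t * incidence ms mt (fun=> 1) s t = 0) -> forall t, x t = 0.

Lemma pchar0_intr_eq0 (K : fieldType) (z : int) :
  [pchar K] =i pred0 -> (z%:~R == 0 :> K) = (z == 0).
Proof.
by move=> /pcharf0P K0; case: z => m; rewrite ?NegzE ?mulrNz ?oppr_eq0 -pmulrn K0.
Qed.

(** The product of all variables is a nonzero polynomial, and it is nonzero exactly off the
    coordinate hyperplanes. *)
Lemma generically_torus (K : fieldType) n (P : ('I_n -> K) -> Prop) :
  (forall a, (forall j, a j != 0) -> P a) -> generically P.
Proof.
move=> aP; exists ('X_[[multinom 1%N | j < n]]).
  apply/eqP => /(congr1 (mcoeff [multinom 1%N | j < n])) /eqP.
  by rewrite mcoeffX eqxx mcoeff0 oner_eq0.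
move=> a; rewrite mevalX => /prodf_neq0 a0; apply: aP => j.
by have := a0 j isT; rewrite mnmE expr1.
Qed.

Section CharacteristicZero.
Variables (K : fieldType) (n : nat) (M : posmon n) (d : nat) (S T : finType).
Variables (ms : S -> 'X_{1..n}) (mt : T -> 'X_{1..n}).
Hypothesis K0 : [pchar K] =i pred0.
Hypotheses (eS : enumerates M d ms) (eT : enumerates M d.+1 mt).
Variable a : 'I_n -> K.
Hypothesis a0 : forall j, a j != 0.

Let torus_neq0 m : 'X_[m].@[a] != 0.
Proof. by rewrite mevalX; apply/prodf_neq0 => j _; rewrite expf_neq0. Qed.

Lemma int_kernel0_surjective :
  int_kernel0 ms mt -> surjective (@mul_linform K n M a d).
Proof.
move=> ker0; apply/(surjective_mul_linform eS eT) => y.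
have [x /ker0 x0 //|N N0 [v vP]] :=
  @int_injective_left_inverse T S (fun t s => incidence ms mt (fun=> 1) s t).
have N0' : N%:~R != 0 :> K by rewrite pchar0_intr_eq0.
(* Scaled by the values at [a] of the monomials [ms s], the integral inverse [v] inverts the
   weighted matrix up to a diagonal of nonzero factors. *)
have inv t t' : \sum_s (v s t')%:~R * 'X_[ms s].@[a] * incidence ms mt a s t =
    'X_[mt t].@[a] * (N%:~R * (t == t')%:R).
  have -> : N%:~R * (t == t')%:R = (N * (t == t')%:R)%:~R :> K.
    by rewrite intrM mulrz_nat.
  rewrite -vP raddf_sum mulr_sumr; apply: eq_bigr => s _ /=.
  rewrite intrM -(incidence_rmorph intr) -mulrA incidence_scale.
  by rewrite mulrCA [_%:~R * _]mulrC.
exists (fun s => \sum_t y t / 'X_[mt t].@[a] / N%:~R * ((v s t)%:~R * 'X_[ms s].@[a])).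
move=> t; under eq_bigr do rewrite mulr_suml.
rewrite exchange_big /= (bigD1 t) //=.
rewrite [X in _ + X]big1 => [|t' t't].
  under eq_bigr do rewrite -mulrA.
  by rewrite addr0 -mulr_sumr inv eqxx mulr1 [_ * N%:~R]mulrC mulrA !divfK.
under eq_bigr do rewrite -mulrA.
by rewrite -mulr_sumr inv eq_sym (negPf t't) !mulr0.
Qed.

Lemma surjective_int_kernel0 :
  surjective (@mul_linform K n M a d) -> int_kernel0 ms mt.
Proof.
move=> /(surjective_mul_linform eS eT) sur x x0 t.
have [y yP] := sur (fun t' => (t == t')%:R); apply/eqP.
rewrite -(pchar0_intr_eq0 _ K0).
(* The rescaled relation [x] annihilates the image of multiplication; pairing it with the basis
   vector at [t], which is in the image, isolates [x t]. *)
suff : \sum_t' (x t')%:~R / 'X_[mt t'].@[a] * (t == t')%:R = 0 :> K.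
  rewrite (bigD1 t) //= eqxx mulr1 big1 => [|t' t't]; last first.
    by rewrite eq_sym (negPf t't) mulr0.
  by rewrite addr0 => /eqP; rewrite mulf_eq0 invr_eq0 (negPf (torus_neq0 _)) orbF.
under eq_bigr do rewrite -yP mulr_sumr.
rewrite exchange_big big1 //= => s _.
have := congr1 (fun z : int => z%:~R * (y s / 'X_[ms s].@[a])) (x0 s).
rewrite mul0r => xs0; rewrite -[RHS]xs0 raddf_sum mulr_suml; apply: eq_bigr => t' _ /=.
rewrite intrM -(incidence_rmorph intr) -!mulrA; congr (_ * _).
have -> : incidence ms mt (fun=> 1) s t' =
    ('X_[mt t'].@[a])^-1 * ('X_[ms s].@[a] * incidence ms mt a s t').
  by rewrite incidence_scale mulKf.
by rewrite -!mulrA; congr (_ * _); rewrite [in RHS]mulrA mulrAC mulrCA divff // mulr1.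
Qed.

End CharacteristicZero.

(** * Faces of the flag complex as normal monomials *)

Section Faces.
Variable n : nat.
Implicit Types (F H : {set 'I_n}) (D : {set {set 'I_n}}).

Lemma setmonE F j : setmon F j = (j \in F).
Proof. by rewrite mnmE. Qed.

Lemma setmon_inj : injective (@setmon n).
Proof.
move=> F H FH; apply/setP => j; have := congr1 (fun m : 'X_{1..n} => m j) FH.
by rewrite !setmonE; case: (j \in F); case: (j \in H).
Qed.

(** Matches the index condition of [boundary] with that of [incidence]. Exponents of [setmon F] are
    at most 1, which forces [j] to lie in [F] and not in [H]. *)
Lemma setmon_addU F H j :
  (setmon F == (setmon H + U_(j))%MM) = (j \in F) && (F :\ j == H).
Proof.
apply/eqP/andP => [FH|[jF /eqP <-]]; last first.
  apply/mnmP => k; rewrite mnmDE mnm1E !setmonE !inE eq_sym.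
  by case: (eqVneq j k) => [<-|_]; rewrite ?jF ?addn0.
have e k : (k \in F) = ((k \in H) + (j == k))%N :> nat.
  by rewrite -!setmonE FH mnmDE mnm1E.
have jF : j \in F by have := e j; rewrite eqxx; case: (j \in F); case: (j \in H).
split=> //; apply/eqP/setP => k; have := e k; rewrite !inE eq_sym.
case: (eqVneq j k) => [<-|_] /=; last by rewrite addn0; case: (k \in F); case: (k \in H).
by rewrite jF; case: (j \in H).
Qed.

Variables (K : fieldType) (G : quadmon n).
Local Notation D := (flag_complex K G).
Hypothesis squareG : forall j, G (U_(j) *+ 2)%MM.

Lemma normal_squarefree m : normal G m -> exists F, m = setmon F.
Proof.
move=> nm; exists [set j | (0 < m j)%N]; apply/mnmP => j; rewrite setmonE inE.
have := nm _ (squareG j); case mj: (m j) => [|[|k]] //.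
case/negP; apply/mnm_lepP => k'; rewrite mulmnE mnm1E.
by case: eqP => // <-; rewrite mj.
Qed.

(** Divisors of a squarefree monomial are squarefree, so the squarefree generators alone decide
    whether [setmon F] is normal. *)
Lemma mem_flag_complex F : reflect (normal G (setmon F)) (F \in D).
Proof.
have sfP g : (g <= setmon F)%MM -> squarefree g.
  move=> /mnm_lepP gF; apply/forallP => j; apply: leq_trans (gF j) _.
  by rewrite setmonE; case: (_ \in _).
rewrite inE; apply: (iffP idP) => [FD g Gg|nF].
  apply: contra FD => gF; apply/mon_idealP => m nm; rewrite mcoeffX.
  case: eqP => // Fm; have := nm g; rewrite inE Gg sfP // -Fm gF.
  by move/(_ isT).
apply/negP => /mon_idealP /(_ (setmon F)); rewrite mcoeffX eqxx => FG.
suff /FG/eqP : normal [pred m | G m && squarefree m] (setmon F).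
  by rewrite oner_eq0.
by move=> g /andP[/nF].
Qed.

(** Serves for I and I(i) alike, as they agree up to degree i+1. A monomial of degree [d] is a face
    of dimension d-1, which the skeleton keeps since d <= i+1. *)
Lemma face_enumerates (M : pred 'X_{1..n}) i d (j : int) :
  (forall m, (mdeg m <= i.+1)%N -> normal M m <-> normal G m) ->
  j = d%:Z - 1 -> (d <= i.+1)%N ->
  enumerates M d (fun F : face (skeleton D i) j => setmon (val F)).
Proof.
move=> MG jd di.
have fP F : (F \in skeleton D i) && (fdim F == j) = (F \in D) && (#|F| == d).
  rewrite inE jd /fdim; case: eqP => [/addIr[->]|Fd]; last first.
    by rewrite andbF; case: eqP => [e|]; [case: Fd; rewrite e|rewrite andbF].
  by rewrite !eqxx !andbT; apply: andb_idr => _; lia.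
split=> [F H /setmon_inj/val_inj //|F|F|m nm md].
- have := valP F; rewrite fP => /andP[/mem_flag_complex nF /eqP Fd].
  by apply/MG; rewrite ?mdeg_setmon ?Fd.
- by have := valP F; rewrite fP mdeg_setmon => /andP[_ /eqP].
have nG : normal G m by apply/MG; rewrite ?md.
have [F mF] := normal_squarefree nG.
have FP : (F \in skeleton D i) && (fdim F == j).
  by rewrite fP -mdeg_setmon -mF md eqxx andbT; apply/mem_flag_complex; rewrite -mF.
by exists (exist _ F FP).
Qed.

Lemma normal_trunc i m : (mdeg m <= i.+1)%N -> normal (trunc_gens G i) m <-> normal G m.
Proof.
move=> mi; split=> nm g; first by move=> Gg; apply: nm; rewrite /= Gg.
case/orP => [/nm //|/eqP gi]; apply/negP => /submK/(congr1 (@mdeg n)).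
by rewrite mdegD gi; lia.
Qed.

End Faces.

(** * Reduction mod 2 and the connecting homomorphism *)

Lemma intr_Fp2_eq0 (z : int) : (z%:~R == 0 :> 'F_2) = (2 %| z)%Z.
Proof. by rewrite (dvdz_pcharf (pchar_Fp (isT : prime 2))). Qed.

(** Halving the values on the basis determines [psi]. *)
Lemma dual_even n (M : posmon n) d (T : finType) (mt : T -> 'X_{1..n})
    (eT : enumerates M d mt) (phi : dual (grpiece int M d)) :
  (forall t, (phi (monomial_class eT t))%:~R = 0 :> 'F_2) ->
  exists psi, phi = psi *+ 2.
Proof.
move=> phi0; have [psi psiP] := dual_surj eT (fun t => (phi (monomial_class eT t) %/ 2)%Z).
exists psi; apply: (eq_dual (eT := eT)) => t.
rewrite mulr2n /= fctE psiP; move/eqP: (phi0 t); rewrite intr_Fp2_eq0.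
by move/divzK => {1}<-; lia.
Qed.

Lemma coker_eqP (U V : zmodType) (f : {additive U -> V}) x y :
  \pi_(coker f) x = \pi_(coker f) y <-> exists u, x - y = f u.
Proof.
split=> [/eqP|xy].
  by rewrite -Quotient.idealrBE => /asboolP.
by apply/eqP; rewrite -Quotient.idealrBE; apply/asboolP.
Qed.

Lemma dual_mul2I (U : zmodType) : injective (fun x : dual U => x *+ 2).
Proof.
move=> x y xy; apply: val_inj; apply: funext => b.
have := congr1 (fun u : dual _ => u b) xy.
by rewrite !mulr2n /= !fctE; lia.
Qed.

Section Connecting.
Variables (K : fieldType) (n : nat) (G : quadmon n) (i : nat).
Hypothesis squareG : forall j, G (U_(j) *+ 2)%MM.

Local Notation D := (flag_complex K G).
Local Notation M := (trunc_gens G i).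
Local Notation S := (face (skeleton D i) (i%:Z - 1)).
Local Notation T := (face (skeleton D i) i).
Local Notation ms := (fun H : S => setmon (val H)).
Local Notation mt := (fun F : T => setmon (val F)).
Local Notation mu_dual := (@mu_dual n G i).
Local Notation delta := (@delta K n G i).

Let eS : enumerates M i ms.
Proof. by apply: face_enumerates => //; exact: normal_trunc. Qed.

Let eT : enumerates M i.+1 mt.
Proof. by apply: face_enumerates => //; [exact: normal_trunc|lia]. Qed.

Let face_classE F : face_class F = monomial_class eT F.
Proof. exact: val_inj. Qed.

Lemma mu_dual_monomial_class phi H : mu_dual phi (monomial_class eS H) =
  \sum_F phi (monomial_class eT F) * incidence ms mt (fun=> 1) H F.
Proof.
rewrite /= (dual_decomp eT); apply: eq_bigr => F _; congr (_ * _).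
rewrite (coord_mul_enum eS eT) (bigD1 H) //= coord_monomial_class eqxx mul1r.
rewrite big1 ?addr0 // => H' H'H.
by rewrite coord_monomial_class eq_sym (negPf H'H) mul0r.
Qed.

Lemma boundary_incidence (z : chain (skeleton D i) i) H :
  boundary z H = \sum_F z F * incidence ms mt (fun=> 1) H F.
Proof.
rewrite ffunE; apply: eq_bigr => F _; rewrite mulr_sumr.
by apply: eq_big => v *; rewrite ?setmon_addU ?mulr1.
Qed.

(** The commuting square of the snake lemma; it makes [mu_dual] of a lift of a cycle even. *)
Lemma boundary_mod2 phi H :
  boundary (@mod2 K n G i phi) H = (mu_dual phi (monomial_class eS H))%:~R.
Proof.
rewrite boundary_incidence mu_dual_monomial_class rmorph_sum.
apply: eq_bigr => F _ /=.
by rewrite ffunE rmorphM /= -(incidence_rmorph intr) face_classE.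
Qed.

Lemma mod2B : {morph @mod2 K n G i : phi psi / phi - psi}.
Proof. by move=> phi psi; apply/ffunP => F; rewrite !ffunE /= rmorphB. Qed.

Lemma mod2_eq0 phi : @mod2 K n G i phi = 0 -> exists psi, phi = psi *+ 2.
Proof.
move=> /ffunP phi0; apply: (dual_even (eT := eT)) => F.
by have := phi0 F; rewrite !ffunE face_classE.
Qed.

Lemma mod2_surj z : exists phi, @mod2 K n G i phi = z.
Proof.
have [phi phiP] := dual_surj eT (fun F => (z F : nat)%:Z).
exists phi; apply/ffunP => F; rewrite ffunE face_classE phiP.
by rewrite -pmulrn natr_Zp.
Qed.

(** A suitable [psi] exists, so the default 0 of [xget] in [delta] is never reached. *)
Lemma deltaE (z : top_homology D i) : exists psi,
  delta z = \pi_(coker mu_dual) psi /\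
  exists2 phi, @mod2 K n G i phi = z & mu_dual phi = psi *+ 2.
Proof.
have [phi phiz] := mod2_surj z.
have [psi psiP] : exists psi, mu_dual phi = psi *+ 2.
  apply: (dual_even (eT := eS)) => H; rewrite -boundary_mod2 phiz.
  have /eqP -> := cycle_ofP z.
  by rewrite ffunE.
exists (xget 0 (fun psi => exists2 phi, @mod2 K n G i phi = z & mu_dual phi = psi *+ 2)).
split=> //; case: xgetP => [? _ //|no].
by case: (no psi); exists phi.
Qed.

Lemma delta_injectiveP : injective delta <-> int_kernel0 ms mt.
Proof.
split=> [inj|ker0 z z' dz]; last first.
  have [psi [zE [phi phiz phiE]]] := deltaE z.
  have [psi' [z'E [phi' phiz' phiE']]] := deltaE z'.
  move: dz; rewrite zE z'E => /coker_eqP[chi chiE].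
  (* The halves differ by [mu_dual chi], so [phi - phi' - chi *+ 2] lies in the kernel, which is
     zero; hence the lifts agree mod 2. *)
  suff phiphi' : phi - phi' = chi *+ 2.
    apply: val_inj; apply/eqP; rewrite /= -phiz -phiz' -subr_eq0 -mod2B phiphi'.
    apply/eqP/ffunP => F; rewrite !ffunE mulr2n /= fctE rmorphD /=.
    by rewrite -mulr2n -mulr_natr pchar_Zp ?mulr0.
  apply/eqP; rewrite -subr_eq0; apply/eqP; apply: (eq_dual (eT := eT)) => F.
  apply: (ker0 (fun F => (phi - phi' - chi *+ 2) (monomial_class eT F))) => H.
  rewrite -mu_dual_monomial_class.
  have -> : mu_dual (phi - phi' - chi *+ 2) = 0; last by [].
  by rewrite !raddfB raddfMn /= phiE phiE' -chiE mulrnBl subrr.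
suff half (x : T -> int) : (forall H, \sum_F x F * incidence ms mt (fun=> 1) H F = 0) ->
    exists2 x' : T -> int, (forall H, \sum_F x' F * incidence ms mt (fun=> 1) H F = 0)
      & forall F, x F = x' F * 2.
  (* Infinite descent on the absolute value of [x F]: halving stays inside the kernel. *)
  move=> x xk F; have [k] := ubnP `|x F|%N; elim: k x xk => // k IHk x xk xF.
  have [x' x'k xx'] := half x xk.
  by move: (IHk x' x'k) xF; rewrite xx'; move: (x' F) => y; clear; lia.
move=> xk; have [phi phiP] := dual_surj eT x.
have phi0 : mu_dual phi = 0.
  apply: (eq_dual (eT := eS)) => H; rewrite mu_dual_monomial_class -[RHS](xk H).
  by apply: eq_bigr => F _; rewrite phiP.
have cyc : @mod2 K n G i phi \in @is_cycle n D i.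
  by apply/eqP/ffunP => H; rewrite boundary_mod2 phi0 /= ffunE.
have [psi [zE [phi' phiz phiE]]] := deltaE (TopHomology cyc).
(* Additivity of [delta] is not at hand, so its value at 0 is computed too; both halves turn out to
   lie in the image of [mu_dual]. *)
have [psi0 [z0E [phi'' phiz0 phiE0]]] := deltaE 0.
have [chi chiE] : exists chi, phi' - phi = chi *+ 2.
  by apply: mod2_eq0; rewrite mod2B phiz subrr.
have [chi0 chiE0] := mod2_eq0 phiz0.
have psiE : psi = mu_dual chi.
  by apply: dual_mul2I; rewrite -raddfMn -chiE raddfB /= phi0 subr0 phiE.
have psiE0 : psi0 = mu_dual chi0.
  by apply: dual_mul2I; rewrite -raddfMn /= -chiE0 phiE0.
have /inj/(congr1 val) /= z0 : delta (TopHomology cyc) = delta 0.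
  by rewrite zE z0E; apply/coker_eqP; exists (chi - chi0); rewrite raddfB /= -psiE -psiE0.
(* By injectivity the cycle is zero, so [phi] is even; its half stays in the kernel because duals
   have no 2-torsion. *)
have [phi2 phi2E] := mod2_eq0 z0.
exists (fun F => phi2 (monomial_class eT F)) => [H|F].
  rewrite -mu_dual_monomial_class; suff -> : mu_dual phi2 = 0 by [].
  by apply: dual_mul2I; rewrite -raddfMn /= -phi2E phi0 mul0rn.
by rewrite -phiP phi2E mulr2n /= fctE; lia.
Qed.

End Connecting.

(** * The Artinian hypothesis, face counts and the two cases *)

(* The powers of (x_j) stabilise in the quotient, so some x_j^N lies in
   I + (x_j^(N+1)); comparing coefficients, x_j^N is divisible by a generator. *)
Lemma artinian_square (K : fieldType) n (G : quadmon n) :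
  artinian (mon_quot K (quad_pos G)) -> forall j, G (U_(j) *+ 2)%MM.
Proof.
move=> art j; pose A := mon_quot K (quad_pos G).
pose xj : A := \pi 'X_j.
have [|k x [y ->]|N JN] := art (fun k x => exists y, x = y * xj ^+ k).
- move=> k; split; first by exists 0; rewrite mul0r.
    by move=> _ _ [u ->] [v ->]; exists (u + v); rewrite mulrDl.
  by move=> a _ [u ->]; exists (a * u); rewrite mulrA.
- by exists (y * xj); rewrite exprS mulrA.
have [|y] := (JN N.+1 (leqnSn _) (xj ^+ N)).2; first by exists 1; rewrite mul1r.
pose m := (U_(j) *+ N)%MM.
have [|nG] := pselect (normal G m); last first.
  have [g Gg gm] : exists2 g, G g & (g <= m)%MM.
    apply: contrapT => ng; apply: nG => g Gg; apply/negP => gm.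
    by apply: ng; exists g.
  (* A divisor of x_j^N of degree 2 can only be x_j^2. *)
  suff <- : g = (U_(j) *+ 2)%MM by [].
  have gk k : k != j -> g k = 0%N.
    move=> kj; have := mnm_lepP gm k.
    by rewrite mulmnE mnm1E eq_sym (negPf kj) mul0n leqn0 => /eqP.
  apply/mnmP => k; rewrite mulmnE mnm1E.
  have [<-|kj] := eqVneq j k; last by rewrite gk // eq_sym.
  by have := quad_gensP Gg; rewrite mdegE (bigD1 j) //= big1 ?addn0.
move=> nm yE; exfalso.
have /eqP : \pi_A ('X_j ^+ N : {mpoly K[n]}) = \pi_A (repr y * 'X_j ^+ N.+1).
  by rewrite rmorphM !rmorphXn /= reprK -/xj yE.
rewrite -Quotient.idealrBE => /mon_idealP /(_ m nm) /eqP.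
rewrite !mpolyXn mcoeffB mcoeffX eqxx mcoeffMX_nle ?subr0 ?oner_eq0 //.
apply/negP => /mnm_lepP /(_ j); rewrite !mulmnE mnm1E eqxx; lia.
Qed.

Lemma card_face n (D : {set {set 'I_n}}) i (j : int) : (j <= i%:Z)%R ->
  #|{: face (skeleton D i) j}| = fvec D j.
Proof.
move=> ji; rewrite card_sig cardE /fvec cardE; congr size.
apply: eq_enum => F; rewrite !inE; case: eqP => [->|]; last by rewrite !andbF.
by rewrite !andbT; apply: andb_idr => _; lia.
Qed.

Theorem proposition3p4 (K : fieldType) (charK0 : [pchar K] =i pred0)
    (r : nat) (G : quadmon r.+1)
    (artA : artinian (mon_quot K (quad_pos G))) (i : nat) :
  let D := flag_complex K G in
  let mu := @mul_ell K r.+1 (quad_pos G) i in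
  let H_nonzero := exists z : top_homology D i, z != 0 in
  (~ injective (@delta K r.+1 G i) ->
     [/\ H_nonzero,
         ~ surjective mu
       & (fvec D i%:Z <= fvec D (i%:Z - 1))%N ->
           fails_WLP K (quad_pos G) i])
  /\
  ((~ H_nonzero -> injective (@delta K r.+1 G i))
   /\ (injective (@delta K r.+1 G i) ->
         surjective mu /\ has_WLP K (quad_pos G) i)).
Proof.
move=> D mu H_nonzero.
have sqG := artinian_square artA.
have eS : enumerates (quad_pos G) i
    (fun H : face (skeleton D i) (i%:Z - 1) => setmon (val H)).
  by apply: face_enumerates.
have eT : enumerates (quad_pos G) i.+1
    (fun F : face (skeleton D i) i => setmon (val F)).
  by apply: face_enumerates => //; lia.
have inj0 : ~ H_nonzero -> injective (@delta K r.+1 G i).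
  move=> H0 z z' _; apply: contrapT => zz'; apply: H0.
  by exists (z - z'); rewrite subr_eq0; apply/eqP.
(* Both sides amount to [int_kernel0], a condition independent of [a]. *)
have sur a (a0 : forall j, a j != 0) : injective (@delta K r.+1 G i) <->
    surjective (@mul_linform K r.+1 (quad_pos G) a i).
  rewrite delta_injectiveP //; split.
    exact: int_kernel0_surjective charK0 eS eT a a0.
  exact: surjective_int_kernel0 charK0 eS eT a a0.
have sur1 : injective (@delta K r.+1 G i) <-> surjective mu.
  by apply: sur => j; exact: oner_neq0.
split=> [ninj|]; split=> //.
- by apply: contrapT => /inj0.
- by move/sur1.
- rewrite -!(@card_face _ _ i) //; last by lia.
  (* Under the inequality of face numbers an injective map would be surjective, so both ways of
     having maximal rank are excluded. *)
  move=> card_le; apply: generically_torus => a a0 [inj|]; last by move/(sur a a0).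
  apply: ninj; apply/(sur a a0)/(surjective_mul_linform eS eT).
  exact: injective_surjective card_le (injective_mul_linform eS eT inj).
move=> inj; split; first exact/sur1.
by apply: generically_torus => a a0; right; apply/(sur a a0).
Qed.
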